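(* The variety of subresiduated semilattices is the equivalent algebraic semantics (in the sense of Blok and Pigozzi) of the $\{\to,\wedge\}$-fragment of the logic $R4^\star$.
   Context: The logic $R4^\star$ is the Hilbert-style calculus in the language $\{\to,\vee,\wedge,\neg\}$ with axiom schemes: (Ax1) $\alpha\to\alpha$; (Ax2) $(\alpha\to\beta)\to((\beta\to\delta)\to(\alpha\to\delta))$; (Ax3) $(\alpha\to(\beta\to\delta))\to((\alpha\to\beta)\to(\alpha\to\delta))$; (C1) $(\alpha\wedge\beta)\to\alpha$; (C2) $(\alpha\wedge\beta)\to\beta$; (C3) $(\delta\to\alpha)\to((\delta\to\beta)\to(\delta\to(\alpha\wedge\beta)))$; (D1) $\alpha\to(\alpha\vee\beta)$; (D2) $\beta\to(\alpha\vee\beta)$; (D3) $(\alpha\to\delta)\to((\beta\to\delta)\to((\alpha\vee\beta)\to\delta))$; (N1) $\neg\alpha\to(\alpha\to\beta)$; (N2) $(\alpha\to\neg\alpha)\to\neg\alpha$; (Dist) $(\alpha\wedge(\beta\vee\delta))\to((\alpha\wedge\beta)\vee(\alpha\wedge\delta))$; and rules (MP) from $\alpha$ and $\alpha\to\beta$ infer $\beta$; (T) from $\alpha$ infer $\beta\to\alpha$. $\Gamma\vdash\alpha$ means there is a finite derivation of $\alpha$ from premises in $\Gamma$ (both rules may be applied to any previously derived formulas). The $\{\to,\wedge\}$-fragment is the restriction of this consequence relation to formulas built with $\to$ and $\wedge$ only. A subresiduated semilattice is an algebra $(A,\wedge,\to,1)$ of type $(2,2,0)$ such that $(A,\wedge)$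 is a meet-semilattice with greatest element $1$ (with associated order $\le$) and for all $x,y,z\in A$: (SR1) $(x\wedge y)\to y=1$; (SR2) $x\to y\le z\to(x\to y)$; (SR3) $x\wedge(x\to y)\le y$; (SR4) $z\to(x\wedge y)=(z\to x)\wedge(z\to y)$. In these algebras $1=x\to x$, so the constant $1$ is term-definable. A quasivariety $\mathbf{Q}$ is the equivalent algebraic semantics of a logic $\vdash$ if there are a finite set $\tau(x)$ of equations and a finite set $\Delta(x,y)$ of formulas such that, with $\models_{\mathbf{Q}}$ the equational consequence relation of $\mathbf{Q}$: $\Gamma\vdash\alpha$ iff $\tau(\Gamma)\models_{\mathbf{Q}}\tau(\alpha)$, and $x\approx y$ is equivalent under $\models_{\mathbf{Q}}$ to $\tau(\Delta(x,y))$. Here the transformers are $\tau(x)=\{x\approx 1\}$ (with $1$ standing for $x\to x$) and $\Delta(x,y)=\{x\to y,\,y\to x\}$. *)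

(* Defs.v *)
From Stdlib Require Import List.
Import ListNotations.

Set Implicit Arguments.
Unset Strict Implicit.

Inductive formula : Type :=
| FVar (n : nat)
| FImp (a b : formula)
| FOr (a b : formula)
| FAnd (a b : formula)
| FNeg (a : formula).

Declare Scope formula_scope.
Delimit Scope formula_scope with F.
Bind Scope formula_scope with formula.
Notation "a --> b" := (FImp a b) (at level 55, right associativity) : formula_scope.
Notation "a \\// b" := (FOr a b) (at level 50, left associativity) : formula_scope.
Notation "a //\\ b" := (FAnd a b) (at level 40, left associativity) : formula_scope.

Inductive R4star_axiom : formula -> Prop :=
| Ax1 a : R4star_axiom (a --> a)
| Ax2 a b d : R4star_axiom ((a --> b) --> ((b --> d) --> (a --> d)))
| Ax3 a b d :
    R4star_axiom ((a --> (b --> d)) --> ((a --> b) --> (a --> d)))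
| C1 a b : R4star_axiom ((a //\\ b) --> a)
| C2 a b : R4star_axiom ((a //\\ b) --> b)
| C3 a b d :
    R4star_axiom ((d --> a) --> ((d --> b) --> (d --> (a //\\ b))))
| D1 a b : R4star_axiom (a --> (a \\// b))
| D2 a b : R4star_axiom (b --> (a \\// b))
| D3 a b d :
    R4star_axiom ((a --> d) --> ((b --> d) --> ((a \\// b) --> d)))
| N1 a b : R4star_axiom (FNeg a --> (a --> b))
| N2 a : R4star_axiom ((a --> FNeg a) --> FNeg a)
| Dist a b d :
    R4star_axiom ((a //\\ (b \\// d)) --> ((a //\\ b) \\// (a //\\ d))).

Inductive R4star (Gamma : formula -> Prop) : formula -> Prop :=
| R4_premise a : Gamma a -> R4star Gamma a
| R4_axiom a : R4star_axiom a -> R4star Gamma a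
| R4_MP a b : R4star Gamma a -> R4star Gamma (a --> b)%F -> R4star Gamma b
| R4_T a b : R4star Gamma a -> R4star Gamma (b --> a)%F.

Inductive term (V : Type) : Type :=
| Var (x : V)
| Imp (s t : term V)
| And (s t : term V).

Fixpoint subst (V W : Type) (f : V -> term W) (t : term V) : term W :=
  match t with
  | Var x => f x
  | Imp s t => Imp (subst f s) (subst f t)
  | And s t => And (subst f s) (subst f t)
  end.

Fixpoint embed (t : term nat) : formula :=
  match t with
  | Var n => FVar n
  | Imp s t => FImp (embed s) (embed t)
  | And s t => FAnd (embed s) (embed t)
  end.

(** Derivations witnessing the consequence may use all four connectives;
    only the premises and the conclusion are restricted. *)
Definition R4star_fragment (Gamma : term nat -> Prop) (a : term nat) : Prop :=
  R4star (fun phi => exists g, Gamma g /\ phi = embed g) (embed a).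

Record algebra : Type := Algebra {
  carrier :> Type;
  meet : carrier -> carrier -> carrier;
  imp : carrier -> carrier -> carrier;
  carrier_inhabited : inhabited carrier
}.

Fixpoint eval (A : algebra) (V : Type) (v : V -> A) (t : term V) : A :=
  match t with
  | Var x => v x
  | Imp s t => imp (eval v s) (eval v t)
  | And s t => meet (eval v s) (eval v t)
  end.

Definition equation (V : Type) : Type := (term V * term V)%type.

Definition satisfies (A : algebra) (V : Type) (v : V -> A) (e : equation V) : Prop :=
  eval v (fst e) = eval v (snd e).

(** Finitely many premises, then the conclusion. *)
Definition quasiequation : Type := (list (equation nat) * equation nat)%type.

Definition valid_equation (A : algebra) (e : equation nat) : Prop :=
  forall v : nat -> A, satisfies v e.

Definition valid_quasiequation (A : algebra) (q : quasiequation) : Prop :=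
  forall v : nat -> A,
    (forall e, In e (fst q) -> satisfies v e) -> satisfies v (snd q).

Definition variety (K : algebra -> Prop) : Prop :=
  exists E : equation nat -> Prop,
    forall A, K A <-> (forall e, E e -> valid_equation A e).

Definition quasivariety (K : algebra -> Prop) : Prop :=
  exists E : quasiequation -> Prop,
    forall A, K A <-> (forall q, E q -> valid_quasiequation A q).

Definition eq_consequence (K : algebra -> Prop)
    (Theta Theta' : equation nat -> Prop) : Prop :=
  forall A : algebra, K A -> forall v : nat -> A,
    (forall e, Theta e -> satisfies v e) ->
    forall e, Theta' e -> satisfies v e.

(** [tau] is a finite set of equations in a single variable; [Delta] is a finite
    set of formulas in two variables, [true] standing for the first one and
    [false] for the second one. *)
Definition apply_tau (tau : list (equation unit)) (Gamma : term nat -> Prop)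
    : equation nat -> Prop :=
  fun e => exists g d, Gamma g /\ In d tau /\
    e = (subst (fun _ => g) (fst d), subst (fun _ => g) (snd d)).

Definition apply_Delta (Delta : list (term bool)) (a b : term nat)
    : term nat -> Prop :=
  fun t => exists d, In d Delta /\
    t = subst (fun i : bool => if i then a else b) d.

Definition equivalent_algebraic_semantics
    (K : algebra -> Prop) (L : (term nat -> Prop) -> term nat -> Prop)
    (tau : list (equation unit)) (Delta : list (term bool)) : Prop :=
  let x := Var 0 in
  let y := Var 1 in
  quasivariety K /\
  (forall (Gamma : term nat -> Prop) (a : term nat),
     L Gamma a <->
     eq_consequence K (apply_tau tau Gamma) (apply_tau tau (eq a))) /\
  eq_consequence K (eq (x, y)) (apply_tau tau (apply_Delta Delta x y)) /\
  eq_consequence K (apply_tau tau (apply_Delta Delta x y)) (eq (x, y)).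

Definition meet_le (A : Type) (meet : A -> A -> A) (x y : A) : Prop :=
  meet x y = x.

Record is_subresiduated_semilattice (A : Type) (meet imp : A -> A -> A) (one : A)
    : Prop := {
  meet_assoc : forall x y z, meet x (meet y z) = meet (meet x y) z;
  meet_comm : forall x y, meet x y = meet y x;
  meet_idem : forall x, meet x x = x;
  one_greatest : forall x, meet_le meet x one;
  SR1 : forall x y, imp (meet x y) y = one;
  SR2 : forall x y z, meet_le meet (imp x y) (imp z (imp x y));
  SR3 : forall x y, meet_le meet (meet x (imp x y)) y;
  SR4 : forall x y z, imp z (meet x y) = meet (imp z x) (imp z y)
}.

(** The class of subresiduated semilattices in the language of the fragment: the
    constant 1, being the value of [x -> x], is left out of the type. *)
Definition subresiduated_semilattices (A : algebra) : Prop :=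
  exists one : A, is_subresiduated_semilattice (@meet A) (@imp A) one.

(** The equation x = 1, with x -> x for the constant 1. *)
Definition tau : list (equation unit) :=
  [(Var tt, Imp (Var tt) (Var tt))].

Definition Delta : list (term bool) :=
  [Imp (Var true) (Var false); Imp (Var false) (Var true)].

(* Main.v *)
(** Write [D] for the set of provable terms, or for [{1}] in a subresiduated
    semilattice. The theories (sets containing [D], closed under modus ponens and
    adjunction) form a preorder, [F] seeing [G] when every implication in [F] is
    in [G], and [x -> y] lies in [F] iff every [G] seen by [F] that contains [x]
    contains [y]: the witness for the converse is [{u | x -> u in F}]. No prime
    theories are needed, since only meet and implication are involved.
    For soundness the theories of the given algebra form a Kripke model, in
    which disjunction and negation can be interpreted too, so derivations may
    pass through the full language. For completeness the theories of the logic
    form a preorder whose powerset, with strict implication, is a subresiduated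
    semilattice refuting every unprovable term. *)

From Stdlib Require Import List FunctionalExtensionality PropExtensionality.
Require Import Defs.
Import ListNotations.

Set Implicit Arguments.
Unset Strict Implicit.

(** * Theories *)

(** [cal_strict] is the scheme x -> (z -> x) for implications x only; weakening in general is just
    the rule [cal_weaken]. *)
Record calculus (X : Type) (meet imp : X -> X -> X) (D : X -> Prop) : Prop := {
  cal_mp : forall x y, D x -> D (imp x y) -> D y;
  cal_weaken : forall x z, D x -> D (imp z x);
  cal_adj : forall x y, D x -> D y -> D (meet x y);
  cal_id : forall x, D (imp x x);
  cal_distr : forall x y z,
    D (imp (imp x (imp y z)) (imp (imp x y) (imp x z)));
  cal_strict : forall x y z, D (imp (imp x y) (imp z (imp x y)));
  cal_projl : forall x y, D (imp (meet x y) x);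
  cal_projr : forall x y, D (imp (meet x y) y);
  cal_pair : forall x y z, D (imp (imp z x) (imp (imp z y) (imp z (meet x y))))
}.

Record theory (X : Type) (meet imp : X -> X -> X) (D : X -> Prop) : Type := Theory {
  th_mem :> X -> Prop;
  th_base : forall x, D x -> th_mem x;
  th_mp : forall x y, th_mem x -> th_mem (imp x y) -> th_mem y;
  th_adj : forall x y, th_mem x -> th_mem y -> th_mem (meet x y)
}.

Section Theories.

Variables (X : Type) (meet imp : X -> X -> X) (D : X -> Prop).
Hypothesis calD : calculus meet imp D.

Definition sees (F G : theory meet imp D) : Prop :=
  forall x y, F (imp x y) -> G (imp x y).

Lemma sees_refl F : sees F F.
Proof. intros x y H; exact H. Qed.

Lemma sees_trans F G H : sees F G -> sees G H -> sees F H.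
Proof. intros FG GH x y Fxy; exact (GH _ _ (FG _ _ Fxy)). Qed.

Definition least_theory : theory meet imp D :=
  Theory (th_mem := D) (fun x Dx => Dx) (cal_mp calD) (cal_adj calD).

Definition theory_under (F : theory meet imp D) (x : X) : theory meet imp D.
Proof.
refine (@Theory X meet imp D (fun u => F (imp x u)) _ _ _).
- intros u Du; apply th_base, (cal_weaken calD), Du.
- intros u w Fu Fuw; apply (th_mp Fu), (th_mp Fuw), th_base, (cal_distr calD).
- intros u w Fu Fw; apply (th_mp Fw), (th_mp Fu), th_base, (cal_pair calD).
Defined.

Lemma theory_imp (F : theory meet imp D) x y :
  F (imp x y) <-> forall G, sees F G -> G x -> G y.
Proof.
split.
- intros Fxy G FG Gx; exact (th_mp Gx (FG _ _ Fxy)).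
- intros H; apply (H (theory_under F x)).
  (* [F] sees the witness because an implication in [F] stays there under the antecedent [x]. *)
  + intros c d Fcd; apply (th_mp Fcd), th_base, (cal_strict calD).
  + change (F (imp x x)); apply th_base, (cal_id calD).
Qed.

Lemma theory_meet (F : theory meet imp D) x y :
  F (meet x y) <-> F x /\ F y.
Proof.
split.
- intros Fxy; split; apply (th_mp Fxy), th_base;
    [apply (cal_projl calD) | apply (cal_projr calD)].
- intros [Fx Fy]; exact (th_adj Fx Fy).
Qed.

End Theories.

(** * Preordered Kripke models *)

Section Kripke.

Variables (W : Type) (R : W -> W -> Prop).
Hypothesis R_refl : forall w, R w w.
Hypothesis R_trans : forall u v w, R u v -> R v w -> R u w.

(** The S4 reading: implication and negation are strict, conjunction and disjunction local. *)
Fixpoint force (val : nat -> W -> Prop) (phi : formula) (w : W) : Prop :=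
  match phi with
  | FVar n => val n w
  | FImp a b => forall u, R w u -> force val a u -> force val b u
  | FOr a b => force val a w \/ force val b w
  | FAnd a b => force val a w /\ force val b w
  | FNeg a => forall u, R w u -> ~ force val a u
  end.

(** Transitivity carries implications along to visible worlds (Ax2, Ax3, C3, D3); reflexivity
    applies them on the spot (Ax3, N2). *)
Lemma force_axiom val phi w : R4star_axiom phi -> force val phi w.
Proof. intros H; destruct H; simpl; firstorder eauto. Qed.

Lemma force_sound val Gamma phi :
  (forall g, Gamma g -> forall w, force val g w) ->
  R4star Gamma phi -> forall w, force val phi w.
Proof.
intros HG d; induction d as [a Ha | a Ha | a b _ IHa _ IHab | a b _ IHa];
  intros w.
- exact (HG _ Ha w).
- exact (force_axiom val w Ha).
- exact (IHab w w (R_refl w) (IHa w)).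
(* Rule T is sound because the induction speaks of all worlds at once. *)
- intros u _ _; exact (IHa u).
Qed.

Definition complex_algebra : algebra :=
  @Algebra (W -> Prop)
    (fun P Q w => P w /\ Q w)
    (fun P Q w => forall u, R w u -> P u -> Q u)
    (inhabits (fun _ => True)).

Lemma complex_algebra_ext (P Q : complex_algebra) :
  (forall w, P w <-> Q w) -> P = Q.
Proof.
intros H; apply functional_extensionality; intros w.
apply propositional_extensionality, H.
Qed.

(** SR2 comes from transitivity and SR3 from reflexivity. *)
Lemma complex_algebra_subresiduated : subresiduated_semilattices complex_algebra.
Proof.
exists (fun _ => True).
split; unfold meet_le; intros; apply complex_algebra_ext; simpl; firstorder eauto.
Qed.

End Kripke.

(** * Subresiduated semilattices *)

Section Subresiduated.

Variables (A : Type) (meet imp : A -> A -> A) (one : A).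
Hypothesis srA : is_subresiduated_semilattice meet imp one.
Local Notation "x <= y" := (meet_le meet x y).

Lemma sr_le_trans x y z : x <= y -> y <= z -> x <= z.
Proof.
unfold meet_le; intros xy yz.
rewrite <- xy at 1; rewrite <- (meet_assoc srA), yz; exact xy.
Qed.

Lemma sr_le_antisym x y : x <= y -> y <= x -> x = y.
Proof. unfold meet_le; intros xy yx; rewrite <- xy, (meet_comm srA); exact yx. Qed.

Lemma sr_one_le x : one <= x -> x = one.
Proof. intros H; apply (sr_le_antisym (one_greatest srA x) H). Qed.

Lemma sr_imp_refl x : imp x x = one.
Proof. rewrite <- (SR1 srA x x), (meet_idem srA); reflexivity. Qed.

Lemma sr_le_imp x y : x <= y <-> imp x y = one.
Proof.
split; intros H.
- rewrite <- (SR1 srA x y), H; reflexivity.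
- pose proof (SR3 srA x y) as H3; rewrite H in H3.
  rewrite (one_greatest srA x) in H3; exact H3.
Qed.

Lemma sr_imp_mono z x y : x <= y -> imp z x <= imp z y.
Proof. unfold meet_le; intros xy; rewrite <- (SR4 srA), xy; reflexivity. Qed.

(* Residuation holds only for implications on the left: it rests on SR2. *)
Lemma sr_residuation a b q r : meet (imp a b) q <= r -> imp a b <= imp q r.
Proof.
intros H; apply (sr_le_trans (SR2 srA a b q)).
replace (imp q (imp a b)) with (imp q (meet (imp a b) q)).
- exact (sr_imp_mono q H).
- rewrite (SR4 srA), sr_imp_refl; apply (one_greatest srA).
Qed.

Lemma sr_calculus : calculus meet imp (fun x => x = one).
Proof.
split.
- intros x y -> H; apply sr_one_le, sr_le_imp, H.
- intros x z ->; apply sr_le_imp, (one_greatest srA).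
- intros x y -> ->; apply (meet_idem srA).
- apply sr_imp_refl.
- intros x y z; apply sr_le_imp, sr_residuation.
  (* By SR4 the two premises meet in [imp x (meet (imp y z) y)], and SR3 bounds the consequent by
     [z]. *)
  rewrite <- (SR4 srA); apply sr_imp_mono.
  rewrite (meet_comm srA); apply (SR3 srA).
- intros x y z; apply sr_le_imp, (SR2 srA).
- intros x y; rewrite (meet_comm srA); apply (SR1 srA).
- apply (SR1 srA).
- intros x y z; apply sr_le_imp, sr_residuation.
  rewrite (SR4 srA); apply (meet_idem srA).
Qed.

End Subresiduated.

(** * Axiomatization by equations *)

(** The constant 1 is written [Imp y y] or [Imp z z] with a variable foreign to the rest of the
    equation, which forces these terms to be constant. *)
Definition subresiduated_equations : list (equation nat) :=
  let x := Var 0 in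
  let y := Var 1 in
  let z := Var 2 in
  [ (And x (And y z), And (And x y) z);
    (And x y, And y x);
    (And x x, x);
    (And x (Imp y y), x);
    (Imp (And x y) y, Imp z z);
    (And (Imp x y) (Imp z (Imp x y)), Imp x y);
    (And (And x (Imp x y)) y, And x (Imp x y));
    (Imp z (And x y), And (Imp z x) (Imp z y)) ].

Lemma subresiduated_equationsP (A : algebra) :
  subresiduated_semilattices A <->
  forall e, In e subresiduated_equations -> valid_equation A e.
Proof.
split.
- intros [one srA] e He v.
  repeat (destruct He as [<- | He]); try contradiction; unfold satisfies; simpl;
    rewrite ?(sr_imp_refl srA); apply srA.
- intros H; rewrite <- Forall_forall in H; unfold subresiduated_equations in H.
  rewrite !Forall_cons_iff in H.
  destruct H as (Hassoc & Hcomm & Hidem & Hone & H1 & H2 & H3 & H4 & _).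
  pose (env (x y z : A) n := match n with 0 => x | 1 => y | _ => z end).
  (* An arbitrary [a] gives the constant as [imp a a]; below, [a] fills the variable through which
     an equation expresses 1. *)
  destruct (carrier_inhabited A) as [a].
  exists (imp a a); split; unfold meet_le.
  + intros x y z; exact (Hassoc (env x y z)).
  + intros x y; exact (Hcomm (env x y y)).
  + intros x; exact (Hidem (env x x x)).
  + intros x; exact (Hone (env x a a)).
  + intros x y; exact (H1 (env x y a)).
  + intros x y z; exact (H2 (env x y z)).
  + intros x y; exact (H3 (env x y y)).
  + intros x y z; exact (H4 (env x y z)).
Qed.

Lemma variety_quasivariety (K : algebra -> Prop) : variety K -> quasivariety K.
Proof.
intros [E HE].
exists (fun q => exists e, E e /\ q = ([], e)); intros A; rewrite HE; split.
- intros H q [e [Ee ->]] v _; exact (H e Ee v).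
- intros H e Ee v; apply (H ([], e)); [exists e; auto | intros e' []].
Qed.

(** * The Lindenbaum calculus and its algebra *)

Lemma R4star_trans Gamma a b c :
  R4star Gamma (FImp a b) -> R4star Gamma (FImp b c) -> R4star Gamma (FImp a c).
Proof.
intros Hab Hbc; apply (R4_MP Hbc), (R4_MP Hab), R4_axiom, Ax2.
Qed.

(** Ax2 turns a -> b into (b -> b) -> (a -> b); rule T gives c -> (b -> b), and Ax2 composes the
    two. *)
Lemma R4star_strict Gamma a b c :
  R4star Gamma (FImp (FImp a b) (FImp c (FImp a b))).
Proof.
apply (@R4star_trans _ _ (FImp (FImp b b) (FImp a b))).
- apply R4_axiom, Ax2.
- apply (@R4_MP _ (FImp c (FImp b b))); [|apply R4_axiom, Ax2].
  apply R4_T, R4_axiom, Ax1.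
Qed.

Lemma fragment_calculus Gamma :
  calculus (@And nat) (@Imp nat) (R4star_fragment Gamma).
Proof.
split; unfold R4star_fragment; simpl.
- intros x y; apply R4_MP.
- intros x z; apply R4_T.
- intros x y Hx Hy.
  (* C3 is taken with [embed x] as common antecedent: rule T supplies both of its premises, and [Hx]
     detaches the antecedent. *)
  apply (R4_MP Hx), (R4_MP (R4_T (embed x) Hy)), (R4_MP (R4_T (embed x) Hx)).
  apply R4_axiom, C3.
- intros; apply R4_axiom, Ax1.
- intros; apply R4_axiom, Ax3.
- intros; apply R4star_strict.
- intros; apply R4_axiom, C1.
- intros; apply R4_axiom, C2.
- intros; apply R4_axiom, C3.
Qed.

Lemma satisfies_tau (A : algebra) (one : A) (v : nat -> A) Gamma :
  is_subresiduated_semilattice (@meet A) (@imp A) one ->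
  (forall e, apply_tau tau Gamma e -> satisfies v e) <->
  (forall g, Gamma g -> eval v g = one).
Proof.
intros srA; split.
- intros H g Gg; rewrite <- (sr_imp_refl srA (eval v g)).
  apply (H (g, Imp g g)); exists g, (Var tt, Imp (Var tt) (Var tt)).
  repeat split; [exact Gg | left; reflexivity].
- intros H e [g [d [Gg [[<- | []] ->]]]]; unfold satisfies; simpl.
  rewrite (sr_imp_refl srA); exact (H g Gg).
Qed.

(** Truth lemma: [theory_imp] and [theory_meet] are exactly the forcing clauses. *)
Lemma force_embed (A : algebra) (one : A) (v : nat -> A)
    (srA : is_subresiduated_semilattice (@meet A) (@imp A) one) t
    (F : theory (@meet A) (@imp A) (fun x => x = one)) :
  force (@sees _ _ _ _) (fun n F => F (v n)) (embed t) F <-> F (eval v t).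
Proof.
revert F; induction t as [n | s IHs t IHt | s IHs t IHt]; intros F; simpl.
- reflexivity.
- rewrite (theory_imp (sr_calculus srA)).
  split; intros H G FG; [rewrite <- IHs, <- IHt | rewrite IHs, IHt]; exact (H G FG).
- rewrite (theory_meet (sr_calculus srA)), IHs, IHt; reflexivity.
Qed.

(** Every theory contains [one], so the premises are forced everywhere, hence so is [a]; at the
    least theory, whose only member is [one], this is the claim. *)
Lemma fragment_sound (A : algebra) (one : A) (v : nat -> A) Gamma a :
  is_subresiduated_semilattice (@meet A) (@imp A) one ->
  R4star_fragment Gamma a -> (forall g, Gamma g -> eval v g = one) ->
  eval v a = one.
Proof.
intros srA Ha HG.
apply (force_embed v srA a (least_theory (sr_calculus srA))).
refine (force_sound (@sees_refl _ _ _ _) (@sees_trans _ _ _ _) _ Ha _).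
intros phi [g [Gg ->]] F; apply (force_embed v srA), th_base, HG, Gg.
Qed.

Definition canonical_algebra (Gamma : term nat -> Prop) : algebra :=
  complex_algebra
    (@sees _ (@And nat) (@Imp nat) (R4star_fragment Gamma)).

Definition canonical_valuation Gamma (n : nat) : canonical_algebra Gamma :=
  fun F => F (Var n).

Lemma eval_canonical Gamma t :
  eval (@canonical_valuation Gamma) t = fun F => F t.
Proof.
induction t as [n | s IHs t IHt | s IHs t IHt]; simpl; [reflexivity | |];
  rewrite IHs, IHt; apply (@complex_algebra_ext _ (@sees _ _ _ _));
  intros F; symmetry.
- apply (theory_imp (fragment_calculus Gamma)).
- apply (theory_meet (fragment_calculus Gamma)).
Qed.

Lemma canonical_algebra_subresiduated Gamma :
  subresiduated_semilattices (canonical_algebra Gamma).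
Proof.
exact (complex_algebra_subresiduated (@sees_refl _ _ _ _) (@sees_trans _ _ _ _)).
Qed.

Lemma fragment_complete Gamma a :
  eq_consequence subresiduated_semilattices
    (apply_tau tau Gamma) (apply_tau tau (eq a)) ->
  R4star_fragment Gamma a.
Proof.
intros H; destruct (canonical_algebra_subresiduated Gamma) as [one srA].
pose proof (H _ (canonical_algebra_subresiduated Gamma)
              (@canonical_valuation Gamma)) as Hv.
rewrite !(satisfies_tau _ _ srA) in Hv.
(* [one] is only known to exist, but it equals [imp one one], a strict implication true at every
   world. *)
assert (one_all : forall F, one F).
{ intros F; rewrite <- (sr_imp_refl srA one); intros G _ HG; exact HG. }
assert (Ha : eval (@canonical_valuation Gamma) a = one).
{ apply Hv; [|reflexivity].
  intros g Gg; rewrite eval_canonical; apply (@complex_algebra_ext _ (@sees _ _ _ _)).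
  intros F; split; intros _; [apply one_all |].
  apply th_base, R4_premise; exists g; split; [exact Gg | reflexivity]. }
rewrite eval_canonical in Ha.
(* The members of the least theory are the derivable terms, so this world refutes every underivable
   one. *)
pose proof (one_all (least_theory (fragment_calculus Gamma))) as Hone.
rewrite <- Ha in Hone; exact Hone.
Qed.

Theorem lemma5p12 :
  variety subresiduated_semilattices /\
  equivalent_algebraic_semantics
    subresiduated_semilattices R4star_fragment tau Delta.
Proof.
assert (HV : variety subresiduated_semilattices)
  by (exists (fun e => In e subresiduated_equations); exact subresiduated_equationsP).
split; [exact HV |]; split; [exact (variety_quasivariety HV) |].
split; [| split].
- intros Gamma a; split; [| apply fragment_complete].
  intros Ha A [one srA] v; rewrite !(satisfies_tau _ _ srA).
  intros HG b <-; exact (fragment_sound srA Ha HG).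
- intros A [one srA] v Hxy; rewrite (satisfies_tau _ _ srA).
  specialize (Hxy _ eq_refl); unfold satisfies in Hxy; simpl in Hxy.
  intros g [d [[<- | [<- | []]] ->]]; simpl; rewrite Hxy; apply (sr_imp_refl srA).
- intros A [one srA] v; rewrite (satisfies_tau _ _ srA).
  intros H e <-; unfold satisfies; simpl.
  apply (sr_le_antisym srA); apply (sr_le_imp srA).
  + apply (H (Imp (Var 0) (Var 1))); exists (Imp (Var true) (Var false)).
    split; [left |]; reflexivity.
  + apply (H (Imp (Var 1) (Var 0))); exists (Imp (Var false) (Var true)).
    split; [right; left |]; reflexivity.
Qed.
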